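(* Let $(Z,\rho)$ be a metric space with at least three points and let $M$ be the Möbius structure induced by $\rho$. Let $\mathcal{T}_\rho$ be the metric topology on $Z$ induced by $\rho$ and let $\mathcal{T}_M$ be the Möbius topology on $Z$ induced by $M$. Then $\mathcal{T}_\rho=\mathcal{T}_M$.
   Context: A quadruple $(z_1,z_2,z_3,z_4)\in Z^4$ is admissible if no three of its entries (at distinct positions) coincide; $\mathcal{A}$ is the set of admissible quadruples. A tuple is non-degenerate if its entries are pairwise distinct. The cross ratio induced by $\rho$ is $cr(z_1,z_2,z_3,z_4)=\frac{\rho(z_1,z_2)\rho(z_3,z_4)}{\rho(z_1,z_3)\rho(z_2,z_4)}\in[0,\infty]$ on $\mathcal{A}$. The Möbius structure (cross difference) induced by $\rho$ is the map $M=(a,b,c)$ on $\mathcal{A}$ given by $$M(z_1,z_2,z_3,z_4)=\big(\ln cr(z_1,z_3,z_4,z_2),\ \ln cr(z_1,z_4,z_2,z_3),\ \ln cr(z_1,z_2,z_3,z_4)\big),$$ with $\ln 0=-\infty$, $\ln\infty=\infty$. Möbius topology. For a non-degenerate triple $A=(\omega,\alpha,\beta)$ in $Z$ and $x,y\in Z$ with $(x,y)\neq(\omega,\omega)$ define $$\rho_A(x,y)=\begin{cases}0 & x=y,\\ e^{a(\alpha,x,\omega,\beta)+a(\alpha,\omega,y,\beta)-a(\alpha,x,y,\beta)} & x\neq y,\ x\neq\beta,\ y\neq\alpha,\\ e^{b(\alpha,x,y,\beta)-b(\alpha,x,\omega,\beta)-b(\alpha,\omega,y,\beta)} & x\neq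 y,\ x\neq\alpha,\ y\neq\beta,\end{cases}$$ (with $e^{\infty}=\infty$), and $\rho_A(\omega,\omega)=0$. The two formulas agree where both apply, and $\rho_A(x,\omega)=\infty$ for $x\ne\omega$. For $y\in Z\setminus\{\omega\}$ and $r>0$ put $B_{A,r}(y)=\{x\in Z\mid \rho_A(x,y)<r\}$. The topology $\mathcal{T}_M$ is the one having as subbasis all sets $B_{A,r}(y)$, over all non-degenerate triples $A=(\omega,\alpha,\beta)$, all $r>0$ and all $y\in Z\setminus\{\omega\}$. *)

(* Defs.v *)
From HB Require Import structures.
From mathcomp Require Import all_boot all_order all_algebra.
From mathcomp Require Import all_classical all_reals all_analysis.
From mathcomp Require Import ring.

Set Implicit Arguments.
Unset Strict Implicit.
Unset Printing Implicit Defensive.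

Import Order.TTheory GRing.Theory Num.Theory.

Local Open Scope classical_set_scope.
Local Open Scope ring_scope.
Local Open Scope ereal_scope.

Definition admissible (Z : eqType) (z1 z2 z3 z4 : Z) : bool :=
  [&& ~~ ((z1 == z2) && (z2 == z3)), ~~ ((z1 == z2) && (z2 == z4)),
      ~~ ((z1 == z3) && (z3 == z4)) & ~~ ((z2 == z3) && (z3 == z4))].

(* In [\bar R], [x / 0 = +oo] for [x > 0]. On admissible quadruples the
   numerator and the denominator do not both vanish; the value on other
   quadruples is junk and is never used below. *)
Definition cr (R : realType) (Z : metricType R) (z1 z2 z3 z4 : Z) : \bar R :=
  (mdist z1 z2 * mdist z3 z4)%:E / (mdist z1 z3 * mdist z2 z4)%:E.

(* A triple (a, b, c) of extended-real functions of four points, of which only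
   the values on admissible quadruples are meaningful. *)
Record cross_difference (R : realType) (Z : Type) := CrossDifference {
  cda : Z -> Z -> Z -> Z -> \bar R;
  cdb : Z -> Z -> Z -> Z -> \bar R;
  cdc : Z -> Z -> Z -> Z -> \bar R }.

Definition mobius_structure (R : realType) (Z : metricType R) :
    cross_difference R Z :=
  {| cda := fun z1 z2 z3 z4 => lne (cr z1 z3 z4 z2);
     cdb := fun z1 z2 z3 z4 => lne (cr z1 z4 z2 z3);
     cdc := fun z1 z2 z3 z4 => lne (cr z1 z2 z3 z4) |}.

Section mobius_balls.
Context (R : realType) (Z : choiceType) (M : cross_difference R Z).
Implicit Types (omega alpha beta x y : Z).

Definition rhoA_a omega alpha beta x y : \bar R :=
  expeR (cda M alpha x omega beta + cda M alpha omega y beta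
         - cda M alpha x y beta).

Definition rhoA_b omega alpha beta x y : \bar R :=
  expeR (cdb M alpha x y beta - cdb M alpha x omega beta
         - cdb M alpha omega y beta).

(* For [alpha != beta] and [x != y], the failure of the condition for the first
   formula ([x = beta] or [y = alpha]) forces the condition for the second one
   ([x != alpha] and [y != beta]). See [rhoA_aE] for the overlap. *)
Definition rhoA omega alpha beta x y : \bar R :=
  if x == y then 0
  else if (x != beta) && (y != alpha) then rhoA_a omega alpha beta x y
  else rhoA_b omega alpha beta x y.

Definition rhoA_ball omega alpha beta (r : R) y : set Z :=
  [set x | rhoA omega alpha beta x y < r%:E].

Definition mobius_subbasis : set (set Z) :=
  [set U | exists omega alpha beta y (r : R),
    [/\ uniq [:: omega; alpha; beta], y != omega, (0 < r)%R &
        U = rhoA_ball omega alpha beta r y]].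

End mobius_balls.

(* An alias of [Z] carrying the topology with subbasis [mobius_subbasis M]. *)
Definition mobius_space (R : realType) (Z : choiceType)
  (M : cross_difference R Z) : Type := Z.

Section mobius_space_topology.
Context (R : realType) (Z : choiceType) (M : cross_difference R Z).

HB.instance Definition _ := Choice.copy (mobius_space M) Z.
HB.instance Definition _ :=
  isSubBaseTopological.Build (mobius_space M) (mobius_subbasis M) id.

End mobius_space_topology.

Definition mobius_topology (R : realType) (Z : choiceType)
  (M : cross_difference R Z) : set (set Z) := @open (mobius_space M).

Definition metric_topology (R : realType) (Z : metricType R) : set (set Z) :=
  @open Z.
Arguments metric_topology {R} Z.

Section rhoA_facts.
Context (R : realType) (Z : metricType R).
Implicit Types (omega alpha beta x y : Z).

Lemma admissible_rhoA_a omega alpha beta x y :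
  uniq [:: omega; alpha; beta] -> x != y -> x != beta -> y != alpha ->
  [&& admissible alpha x omega beta, admissible alpha omega y beta
    & admissible alpha x y beta].
Proof.
rewrite /= !inE !negb_or andbT -andbA => /and3P[/eqP oa /eqP ob /eqP ab].
move=> /eqP xy /eqP xb /eqP ya.
by rewrite /admissible; apply/and3P; split; apply/and4P; split;
  apply/negP => /andP[/eqP ? /eqP ?]; congruence.
Qed.

Lemma admissible_rhoA_b omega alpha beta x y :
  uniq [:: omega; alpha; beta] -> x != y -> x != alpha -> y != beta ->
  [&& admissible alpha x y beta, admissible alpha x omega beta
    & admissible alpha omega y beta].
Proof.
rewrite /= !inE !negb_or andbT -andbA => /and3P[/eqP oa /eqP ob /eqP ab].
move=> /eqP xy /eqP xb /eqP ya.
by rewrite /admissible; apply/and3P; split; apply/and4P; split;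
  apply/negP => /andP[/eqP ? /eqP ?]; congruence.
Qed.

Lemma rhoA_aE omega alpha beta x y :
  uniq [:: omega; alpha; beta] -> x != y ->
  x != beta -> y != alpha -> x != alpha -> y != beta ->
  rhoA_a (mobius_structure Z) omega alpha beta x y =
  rhoA_b (mobius_structure Z) omega alpha beta x y.
Proof.
rewrite /= !inE !negb_or andbT -andbA => /and3P[oa ob ab] xy xb ya xa yb.
rewrite /rhoA_a /rhoA_b /=; congr expeR.
have lnq (p q : R) : (0 < p)%R -> (0 < q)%R ->
    lne (p%:E / q%:E) = (ln p - ln q)%:E.
  move=> p0 q0; rewrite /inve /= gt_eqF// -EFinM lne_EFin ?divr_gt0//.
  by rewrite ln_div.
have lnq0 (p : R) : (0 < p)%R -> lne (p%:E / 0%:E) = +oo.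
  by move=> p0; rewrite /inve /= eqxx gt0_muley// lte_fin.
have ln0q (q : R) : (0 < q)%R -> lne (0%:E / q%:E) = -oo.
  by move=> q0; rewrite mul0e /= lexx.
have P (u v : Z) : u != v -> (0 < mdist u v)%R by rewrite mdist_gt0.
have neq_symm (u v : Z) : u != v -> v != u by rewrite eq_sym.
have [ao bo] := (neq_symm _ _ oa, neq_symm _ _ ob).
have [ba yx] := (neq_symm _ _ ab, neq_symm _ _ xy).
have [bx ay] := (neq_symm _ _ xb, neq_symm _ _ ya).
have [ax by_] := (neq_symm _ _ xa, neq_symm _ _ yb).
have lnM' (p q : R) : (0 < p)%R -> (0 < q)%R -> ln (p * q) = (ln p + ln q)%R.
  by move=> *; rewrite lnM// posrE.
rewrite /cr; case: (eqVneq x omega) => [xo|xo].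
  subst x; rewrite mdistxx ?(mulr0, mul0r).
  rewrite lnq0 ?ln0q ?lnq ?mulr_gt0 ?P //.
case: (eqVneq y omega) => [yo|yo].
  subst y; rewrite mdistxx ?(mulr0, mul0r).
  rewrite lnq0 ?ln0q ?lnq ?mulr_gt0 ?P //.
have [ox oy] := (neq_symm _ _ xo, neq_symm _ _ yo).
rewrite !lnq ?mulr_gt0 ?P // -?EFinN -?EFinD !lnM' ?P //.
rewrite (metric_sym omega y) (metric_sym beta x) (metric_sym beta omega).
rewrite (metric_sym beta y) (metric_sym omega x) (metric_sym y x).
congr EFin; ring.
Qed.

End rhoA_facts.

(* Main.v *)
Require Import Defs.
From HB Require Import structures.
From mathcomp Require Import all_boot all_order all_algebra.
From mathcomp Require Import all_classical all_reals all_analysis.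
From mathcomp Require Import ring lra.

(** For distinct [x] and [y] other than [omega], [rhoA omega alpha beta x y] is
    the metric inversion [C * d x y / (d x omega * d y omega)], where
    [C = d alpha omega * d beta omega / d alpha beta > 0]: both defining
    formulas are this product, written through logarithms of cross ratios. For
    [y != omega], the ball of radius [r] around [y] is therefore
    [{x | C * d x y < r * (d x omega * d y omega)}] ([rhoA_ballE]); the point
    [x = omega], at infinite distance, is excluded by this inequality too.

    Such a set is metrically open, as both sides depend continuously on [x].
    Conversely, for [p], [e > 0] and a triple with [omega != p], the triangle
    inequality gives [d x omega <= d x p + D] with [D = d p omega], so that the
    inequality defining the ball around [p] implies
    [(C - r * D) * d x p < r * D ^+ 2]; a small enough [r] turns this into
    [d x p < e]. Hence a single subbasic set suffices inside each metric
    ball. *)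

Import Order.TTheory GRing.Theory Num.Theory.
Local Open Scope classical_set_scope.
Local Open Scope ring_scope.

Lemma mobius_subbasis_open (R : realType) (Z : choiceType)
    (M : cross_difference R Z) (U : set Z) :
  mobius_subbasis M U -> mobius_topology M U.
Proof.
move=> MU; exists [set U]; last by rewrite bigcup_set1.
by move=> _ ->; exact: (@finI_from1 (set Z) Z (mobius_subbasis M) id U).
Qed.

(** The Möbius topology is the coarsest one in which subbasic sets are open. *)
Lemma mobius_topology_sub (R : realType) (Z : topologicalType)
    (M : cross_difference R Z) :
  mobius_subbasis M `<=` @open Z -> mobius_topology M `<=` @open Z.
Proof.
move=> Mopen _ [B BM <-]; apply: bigcup_open => i /BM[F FM <-].
rewrite bigcap_fset big_seq; apply: big_ind => [|A B' oA oB|A FA].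
- exact: openT.
- exact: openI.
- by apply: Mopen; have := FM _ FA; rewrite inE.
Qed.

Section inversion.
Set Implicit Arguments.
Unset Strict Implicit.
Context (R : realType) (Z : metricType R).
Implicit Types (omega alpha beta x y : Z).
Local Notation d := (@mdist R Z).

(** The constant relating [rhoA] to the metric inversion at [omega]. *)
Definition inversion_scale omega alpha beta : R :=
  d alpha omega * d beta omega / d alpha beta.

Lemma inversion_scale_gt0 omega alpha beta :
  uniq [:: omega; alpha; beta] -> 0 < inversion_scale omega alpha beta.
Proof.
rewrite /= !inE !negb_or andbT -andbA => /and3P[oa ob ab].
by rewrite divr_gt0 ?mulr_gt0// mdist_gt0// eq_sym.
Qed.

Let lnq (p q : R) : 0 < p -> 0 < q -> lne (p%:E / q%:E)%E = (ln p - ln q)%:E.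
Proof.
move=> p0 q0; rewrite /inve /= gt_eqF// -EFinM lne_EFin ?divr_gt0//.
by rewrite ln_div.
Qed.

Let lnq0 (p : R) : 0 < p -> lne (p%:E / 0%:E)%E = +oo%E.
Proof. by move=> p0; rewrite /inve /= eqxx gt0_muley// lte_fin. Qed.

Let ln0q (q : R) : lne (0%:E / q%:E)%E = -oo%E.
Proof. by rewrite mul0e /= lexx. Qed.

Let lnM' (p q : R) : 0 < p -> 0 < q -> ln (p * q) = ln p + ln q.
Proof. by move=> *; rewrite lnM// posrE. Qed.

Lemma rhoA_omega omega alpha beta y :
  uniq [:: omega; alpha; beta] -> y != omega ->
  rhoA (mobius_structure Z) omega alpha beta omega y = +oo%E.
Proof.
rewrite /= !inE !negb_or andbT -andbA => /and3P[oa ob ab] yo.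
have P (u v : Z) : u != v -> 0 < d u v by rewrite mdist_gt0.
have neq_symm (u v : Z) : u != v -> v != u by rewrite eq_sym.
have [ao bo] := (neq_symm _ _ oa, neq_symm _ _ ob).
have [ba oy] := (neq_symm _ _ ab, neq_symm _ _ yo).
rewrite /rhoA eq_sym (negbTE yo) ob /=; case: (eqVneq y alpha) => [ya|ya] /=.
  rewrite /rhoA_b /= /cr -ya mdistxx ?(mulr0, mul0r).
  by rewrite ya ln0q !lnq ?mulr_gt0 ?P.
have ay := neq_symm _ _ ya.
by rewrite /rhoA_a /= /cr mdistxx ?(mulr0, mul0r) lnq0 ?lnq ?mulr_gt0 ?P.
Qed.

Lemma rhoA_inversion omega alpha beta x y :
  uniq [:: omega; alpha; beta] -> x != omega -> y != omega -> x != y ->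
  rhoA (mobius_structure Z) omega alpha beta x y =
  (inversion_scale omega alpha beta * d x y / (d x omega * d y omega))%:E.
Proof.
move=> Au; have C0 := inversion_scale_gt0 Au; move: Au.
rewrite /= !inE !negb_or andbT -andbA => /and3P[oa ob ab] xo yo xy.
have P (u v : Z) : u != v -> 0 < d u v by rewrite mdist_gt0.
have neq_symm (u v : Z) : u != v -> v != u by rewrite eq_sym.
have [ao bo] := (neq_symm _ _ oa, neq_symm _ _ ob).
have [ba yx] := (neq_symm _ _ ab, neq_symm _ _ xy).
have [ox oy] := (neq_symm _ _ xo, neq_symm _ _ yo).
have lnC : ln (inversion_scale omega alpha beta) =
    ln (d alpha omega) + ln (d beta omega) - ln (d alpha beta).
  by rewrite /inversion_scale ln_div ?posrE ?mulr_gt0 ?P// lnM' ?P.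
move: (inversion_scale _ _ _) C0 lnC => C C0 lnC.
have Q : 0 < C * d x y / (d x omega * d y omega).
  by rewrite divr_gt0 ?mulr_gt0 ?P.
rewrite -[in RHS](lnK Q) ln_div ?posrE ?mulr_gt0 ?P// !lnM' ?P// lnC.
rewrite /rhoA (negbTE xy); case: ifPn => [/andP[xb ya]|].
  have [bx ay] := (neq_symm _ _ xb, neq_symm _ _ ya).
  rewrite /rhoA_a /= /cr !lnq ?mulr_gt0 ?P// -?EFinN -?EFinD /=.
  rewrite !lnM' ?P//; congr (expR _)%:E.
  rewrite (metric_sym omega x) (metric_sym y x); ring.
move=> xbya.
have [xa yb] : x != alpha /\ y != beta.
  by move: xbya; rewrite negb_and !negbK => /orP[] /eqP E; subst.
have [ax by_] := (neq_symm _ _ xa, neq_symm _ _ yb).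
rewrite /rhoA_b /= /cr !lnq ?mulr_gt0 ?P// -?EFinN -?EFinD /=.
rewrite !lnM' ?P//; congr (expR _)%:E.
rewrite (metric_sym omega y); ring.
Qed.

(** The inequality needs no case distinction: [omega] violates it and [y]
    satisfies it, in agreement with their [rhoA]-distances [+oo] and [0] to
    [y]. *)
Lemma rhoA_ballE omega alpha beta y (r : R) :
  uniq [:: omega; alpha; beta] -> y != omega -> 0 < r ->
  rhoA_ball (mobius_structure Z) omega alpha beta r y =
  [set x | inversion_scale omega alpha beta * d x y <
           r * (d x omega * d y omega)].
Proof.
move=> Au yo r0; have C0 := inversion_scale_gt0 Au.
apply/funext => x; rewrite /rhoA_ball /=; apply/propext.
have [->|xo] := eqVneq x omega.
  rewrite rhoA_omega// mdistxx mul0r mulr0; split => //.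
  by rewrite ltNge mulr_ge0 ?mdist_ge0// ltW.
have [->|xy] := eqVneq x y.
  rewrite /rhoA eqxx mdistxx mulr0 lte_fin r0.
  by rewrite !mulr_gt0// mdist_gt0.
rewrite rhoA_inversion// lte_fin ltr_pdivrMr//.
by rewrite mulr_gt0// mdist_gt0.
Qed.

Lemma rhoA_ball_open omega alpha beta y (r : R) :
  uniq [:: omega; alpha; beta] -> y != omega -> 0 < r ->
  open (rhoA_ball (mobius_structure Z) omega alpha beta r y).
Proof.
move=> Au yo r0; rewrite rhoA_ballE//; have := inversion_scale_gt0 Au.
set C := inversion_scale _ _ _ => C0.
have D0 : 0 < d y omega by rewrite mdist_gt0.
set D := d y omega in D0 *.
rewrite openE => p /= Bp; apply/nbhs_ballP.
have rD0 : 0 < r * D by rewrite mulr_gt0.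
have K0 : 0 < r * D + C by rewrite addr_gt0.
(* The difference of the two sides is Lipschitz in [x], of constant
   [r * D + C]. *)
exists ((r * (d p omega * D) - C * d p y) / (r * D + C)).
  by rewrite /= divr_gt0// subr_gt0.
move=> x; rewrite ballEmdist /= ltr_pdivlMr// => px.
have H1 : r * D * d p omega <= r * D * (d p x + d x omega).
  apply: ler_wpM2l; [exact: ltW|exact: metric_triangle].
have H2 : C * d x y <= C * (d p x + d p y).
  rewrite (metric_sym p x).
  apply: ler_wpM2l; [exact: ltW|exact: metric_triangle].
lra.
Qed.

(** Each metric ball around a point [p != omega] contains a subbasic set
    centred at [p], with the same [omega]. *)
Lemma rhoA_ball_sub_ball omega alpha beta p (e : R) :
  uniq [:: omega; alpha; beta] -> p != omega -> 0 < e ->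
  exists2 r : R, 0 < r &
    rhoA_ball (mobius_structure Z) omega alpha beta r p `<=` ball p e.
Proof.
move=> Au po e0; have := inversion_scale_gt0 Au.
move EC : (inversion_scale _ _ _) => C C0.
have D0 : 0 < d p omega by rewrite mdist_gt0.
set D := d p omega in D0 *.
have De0 : 0 < D + e by rewrite addr_gt0.
(* This [r] solves [r * D ^+ 2 = e * (C - r * D)]. *)
pose r := e * C / (D * (D + e)).
have r0 : 0 < r by apply: divr_gt0; apply: mulr_gt0.
exists r => //; rewrite rhoA_ballE// EC -/D => x /= xB.
rewrite ballEmdist /= metric_sym.
have rE : r * D * (D + e) = e * C.
  by rewrite /r; field; apply/andP; split; rewrite gt_eqF.
have H : r * D * d x omega <= r * D * (d x p + D).
  apply: ler_wpM2l; [exact/ltW/mulr_gt0|exact: metric_triangle].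
have CrD : 0 < C - r * D.
  have rDD0 : 0 < r * D * D by apply: mulr_gt0 => //; exact: mulr_gt0.
  rewrite -(pmulr_rgt0 _ e0).
  lra.
(* Multiplied by [C - r * D], the goal [d x p < e] follows from
   [(C - r * D) * d x p < r * D ^+ 2]. *)
rewrite -(ltr_pM2l CrD); lra.
Qed.

Lemma ex_triple_neq p : (exists x y z : Z, uniq [:: x; y; z]) ->
  exists omega alpha beta, uniq [:: omega; alpha; beta] /\ p != omega.
Proof.
move=> [x [y [z u]]]; have [->|px] := eqVneq p x; last by exists x, y, z.
exists y, x, z; move: u; rewrite /= !inE !negb_or (eq_sym y x).
by move=> /andP[/andP[-> ->] ->].
Qed.

End inversion.

Theorem theorem1 (R : realType) (Z : metricType R)
  (hZ : exists x y z : Z, uniq [:: x; y; z]) :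
  metric_topology Z = mobius_topology (mobius_structure Z).
Proof.
apply/seteqP; split; last first.
  apply: mobius_topology_sub => _ [omega [alpha [beta [y [r [Au yo r0 ->]]]]]].
  exact: rhoA_ball_open.
move=> U; rewrite /metric_topology /= openE => Uo.
change (@open (mobius_space (mobius_structure Z)) U).
rewrite openE => p Up; rewrite /interior nbhsE /=.
have /nbhs_ballP[e /= e0 eU] := Uo _ Up.
have [omega [alpha [beta [Au po]]]] := ex_triple_neq p hZ.
have [r r0 rU] := rhoA_ball_sub_ball Au po e0.
exists (rhoA_ball (mobius_structure Z) omega alpha beta r p).
  split; last by rewrite /rhoA_ball /= /rhoA eqxx lte_fin.
  by apply: mobius_subbasis_open; exists omega, alpha, beta, p, r.
exact: subset_trans eU.
Qed.
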